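(* $$\liminf_{n \to \infty} \frac{f(n) - n}{\sqrt{n}} \geq \sqrt{2 + \frac{40}{99}}.$$
   Context: Graphs are finite and undirected; loops and multiple edges are allowed, a loop being a cycle of length $1$ and a pair of parallel edges forming a cycle of length $2$. For a positive integer $n$, $f(n)$ denotes the maximum number of edges in a graph with $n$ vertices in which no two distinct cycles have the same length. *)

(* Defs.v *)
From mathcomp Require Import all_boot boolp.

Set Implicit Arguments.
Unset Strict Implicit.
Unset Printing Implicit Defensive.

(* [ends e] has one element exactly when [e] is a loop; parallel edges are    *)
(* distinct edges with the same [ends].                                       *)
Record multigraph := Multigraph {
  vertex : finType;
  edge : finType;
  ends : edge -> {set vertex};
  ends_card : forall e, 0 < #|ends e| <= 2
}.

(* A cycle is identified with its edge set, which determines it as a          *)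
(* subgraph; its length is then the cardinal of that set.  [ordS] is the      *)
(* cyclic successor on 'I_k: k = 1 gives a loop, and k = 2 two distinct       *)
(* parallel edges.                                                            *)
Definition is_cycle (G : multigraph) (C : {set edge G}) : Prop :=
  exists (k : nat) (v : 'I_k -> vertex G) (e : 'I_k -> edge G),
    [/\ 0 < k, injective v, injective e,
        forall i, ends (e i) = [set v i; v (ordS i)]
      & C = [set e i | i : 'I_k]].

Definition distinct_cycle_lengths (G : multigraph) : Prop :=
  forall C D : {set edge G}, is_cycle C -> is_cycle D -> C <> D -> #|C| <> #|D|.

Definition attainable (n : nat) : pred nat := fun m =>
  `[< exists G : multigraph,
        [/\ #|vertex G| = n, #|edge G| = m & distinct_cycle_lengths G] >].

Lemma loop_cycle (G : multigraph) (e : edge G) x :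
  ends e = [set x] -> is_cycle [set e].
Proof.
move=> ex; exists 1, (fun=> x), (fun=> e); split=> //.
- by move=> i j _; rewrite !ord1.
- by move=> i j _; rewrite !ord1.
- by move=> _; rewrite setUid.
- apply/setP=> a; rewrite inE; apply/eqP/imsetP => [->|[_ _ ->]] //.
  by exists ord0.
Qed.

Lemma parallel_cycle (G : multigraph) (e1 e2 : edge G) x y :
  e1 != e2 -> x != y -> ends e1 = [set x; y] -> ends e2 = [set x; y] ->
  is_cycle [set e1; e2].
Proof.
move=> ne nxy h1 h2.
pose sel (T : Type) (a b : T) (i : 'I_2) := if i == ord0 then a else b.
have sel_inj (T : eqType) (a b : T) : a != b -> injective (sel T a b).
  move=> nab [[|[|//]] ?] [[|[|//]] ?]; rewrite /sel /= => h; try exact: val_inj.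
  - by rewrite h eqxx in nab.
  - by rewrite h eqxx in nab.
exists 2, (sel _ x y), (sel _ e1 e2); split=> //; try exact: sel_inj.
- by move=> [[|[|//]] ?]; rewrite /sel /= ?h1 // h2 setUC.
- apply/setP=> a; rewrite !inE; apply/orP/imsetP => [[]/eqP->|[i _ ->]].
  + by exists ord0.
  + by exists ord_max.
  + by rewrite /sel; case: ifP; [left|right].
Qed.

Lemma attainable_ex n : exists m, attainable n m.
Proof.
exists 0; apply/asboolP.
have c0 (e : 'I_0) : 0 < #|(set0 : {set 'I_n})| <= 2 by case: e.
exists (Multigraph c0); split; rewrite /= ?card_ord // => C D [k [v [e [k0 _ _ _ _]]]].
by case: (e (Ordinal k0)).
Qed.

(* A crude bound: at most two edges share the same [ends].                    *)
Lemma attainable_le n m : attainable n m -> m <= 2 ^ n * 2.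
Proof.
move=> /asboolP[G [<- <- dG]].
rewrite -sum1_card (partition_big (@ends G) predT) //=.
have -> : 2 ^ #|vertex G| = #|{set vertex G}| by rewrite -[RHS]cardsT -powersetT card_powerset cardsT.
rewrite -sum_nat_const; apply: leq_sum => S _; rewrite sum1_card leqNgt.
apply/negP => /card_gt2P[e1 [e2 [e3 [[]]]]].
rewrite ![_ \in _]/(ends _ == S) => /eqP E1 /eqP E2 /eqP E3 [n12 n23 n31].
have := ends_card e1; rewrite E1 => /andP[S0]; rewrite leq_eqVlt => /orP[|S1].
  move=> /cards2P[x [y [nxy Sxy]]]; rewrite {}Sxy in E1 E2 E3.
  have := dG _ _ (parallel_cycle n12 nxy E1 E2) (parallel_cycle n23 nxy E2 E3).
  rewrite !cards2 n12 n23; apply=> // /setP/(_ e1).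
  by rewrite !inE eqxx (negPf n12) eq_sym (negPf n31).
have /cards1P[x Sx] : #|S| == 1 by rewrite eqn_leq -ltnS S1.
rewrite {}Sx in E1 E2.
have := dG _ _ (loop_cycle E1) (loop_cycle E2).
rewrite !cards1; apply=> // /set1_inj e12.
by rewrite e12 eqxx in n12.
Qed.

Definition max_edges (n : nat) : nat :=
  ex_maxn (attainable_ex n) (@attainable_le n).

(* Main.v *)
Require Import Defs.
From mathcomp Require Import all_boot boolp zify.

(** The lower bound comes from an explicit family of graphs.  Take a rooted
    forest in which some vertices are marked as tips, and add a hub joined to
    every root and to every tip.  With V vertices and t tips in the forest, the
    graph has V + 1 vertices and V + t edges, so t measures the excess of edges
    over vertices.  The stem edges (from a vertex to its parent, or from a root
    to the hub) form a spanning tree, hence a cycle is determined by its back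
    edges, those that join tips to the hub; since a cycle has degree at most 2
    at the hub, these are either a single one, at a tip of depth d, and the
    cycle has length d + 1, or two of them, at two tips of one tree at distance
    d, and the cycle has length d + 2 ([cycle_apex], [forest_graph_distinct]).
    So it suffices to build forests with many tips and few vertices in which
    all these numbers are distinct ([forest_attainable]).

    The forest consists of about M scaled copies of each of finitely many
    templates, M being a large integer.  A template is a binary tree whose
    segments carry two numbers, a multiple y of a large unit h * M and a residue
    r.  The i-th copy gives length h * M * y + r to an inner segment, and
    h * i more to a segment that ends at a tip or at the hub.  Every cycle of
    the copy is a path between two such ends, so its length is h * (M * Y + 2 * i)
    + R, where Y and R are the sums of the y and r along that path.  When Y is
    even, these lengths fill, as i varies, the residue class of R modulo
    2 * h inside the interval of length 2 * h * M indexed by Y, up to O(1)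
    terms.  Distinctness of all cycle lengths thus reduces to a finite
    condition: the pairs (Y, R mod 2 * h) of all cycles of all templates are
    distinct ([copies_uniq]).

    If the templates have G tips in total, then the copies have G * M - O(1)
    tips and at most W / 2 * M ^ 2 + O(M) vertices, where W is [weight], so that
    the lower limit is at least sqrt (2 * G ^ 2 / W) ([limn_einf_copies]).
    Single paths alone give only sqrt 2; larger trees have more cycles per
    edge, and the templates listed at the end have G = 116 and W = 11180, with
    2 * 116 ^ 2 / 11180 = 2.407... > 2 + 40 / 99. *)

Set Implicit Arguments.
Unset Strict Implicit.
Unset Printing Implicit Defensive.

(** * Degrees and cuts of a cycle *)

Lemma cycle_degree (G : multigraph) (C : {set edge G}) (z : vertex G) :
    (forall e : edge G, #|ends e| = 2) -> is_cycle C ->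
  #|[set e in C | z \in ends e]| = 0 \/ #|[set e in C | z \in ends e]| = 2.
Proof.
move=> ends2 [k [v [e [_ v_inj e_inj endsE ->]]]].
have -> : [set x in [set e i | i : 'I_k] | z \in ends x]
        = e @: [set i | z \in [set v i; v (ordS i)]].
  apply/setP=> x; rewrite inE; apply/andP/imsetP => [[/imsetP[i _ ->]]|[i]].
    by rewrite endsE => zi; exists i; rewrite ?inE // -in_set2.
  by rewrite inE -endsE => zi ->; split=> //; apply: imset_f.
rewrite card_imset //.
have [/codomP[j ->]|zNv] := boolP (z \in codom v); [right|left].
  have -> : [set i | v j \in [set v i; v (ordS i)]] = [set j; ord_pred j].
    apply/setP=> i; rewrite !inE !(inj_eq v_inj) eq_sym; congr orb.
    by apply/eqP/eqP => [->|->]; rewrite ?ordSK ?ord_predK.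
  have := ends2 (e j); rewrite endsE !cards2 (inj_eq v_inj).
  case: eqVneq => // jS _; case: eqVneq => // jP.
  by case/eqP: jS; rewrite {2}jP ord_predK.
apply/eqP; rewrite cards_eq0 -subset0; apply/subsetP => i; rewrite !inE.
by case/orP=> /eqP zE; rewrite zE codom_f in zNv.
Qed.

(** A cycle meets every edge cut an even number of times: edges with both ends
    in [T] contribute 2 to the sum, edges of the cut contribute 1. *)
Lemma cycle_cut_even (G : multigraph) (C : {set edge G}) (T : {set vertex G}) :
    (forall e : edge G, #|ends e| = 2) -> is_cycle C ->
  ~~ odd (\sum_(e in C) #|ends e :&: T|).
Proof.
move=> ends2 Cc.
have -> : \sum_(e in C) #|ends e :&: T|
        = \sum_(z in T) #|[set e in C | z \in ends e]|.
  under eq_bigr => e _ do rewrite -sum1_card.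
  under [RHS]eq_bigr => e _ do rewrite -sum1_card.
  rewrite (exchange_big_dep (mem T)) /=; last by move=> e z _; rewrite inE => /andP[].
  apply: eq_bigr => z zT; apply: eq_bigl => e.
  by rewrite !inE zT andbT.
elim/big_ind: _ => // [m n m0 n0|z _]; first by rewrite oddD (negPf m0) (negPf n0).
by case: (cycle_degree z ends2 Cc) => ->.
Qed.

(** * The graph of a rooted forest with a hub *)

(** [le u w] is the ancestor order of the forest: [u] lies on the path from [w]
    to its root. *)
Section ApexGraph.
Variables (W : finType) (par : W -> option W) (le : rel W) (term : pred W).
Hypothesis le_par : forall u w, le u w = (w == u) || oapp (le u) false (par w).
Hypothesis par_nle : forall w u, par w = Some u -> ~~ le w u.

Let lexx w : le w w. Proof. by rewrite le_par eqxx. Qed.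

(** The vertices are [option W], with [None] as the hub; [inl w] is the stem
    edge above [w], and [inr w] is the back edge at the marked vertex [w]. *)
Definition apex_ends (e : W + {w | term w}) : {set option W} :=
  match e with
  | inl w => [set Some w; par w]
  | inr w => [set Some (val w); None]
  end.

Lemma apex_ends2 e : #|apex_ends e| = 2.
Proof.
case: e => [w|w] /=; rewrite cards2 //=; case: eqVneq => // /esym wE.
by have := par_nle wE; rewrite lexx.
Qed.

Lemma apex_ends_card e : 0 < #|apex_ends e| <= 2.
Proof. by rewrite apex_ends2. Qed.

Definition apex_graph := Multigraph apex_ends_card.

(** The sum modulo 2 of the fundamental cycles of the back edges at [B]. *)
Definition apex_cycle (B : {set W}) : {set edge apex_graph} :=
  [set e : W + {w | term w} | match e with
     | inl w => odd #|[set b in B | le w b]|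
     | inr b => val b \in B
     end].

Definition admissible (B : {set W}) :=
  (exists2 b, term b & B = [set b]) \/
  (exists b1 b2, [/\ term b1, term b2, b1 != b2, B = [set b1; b2] &
     forall r, par r = None -> le r b1 = le r b2]).

Lemma card_apex_cycle (B : {set W}) : {subset B <= term} ->
  #|apex_cycle B| = #|B| + #|[set w | odd #|[set b in B | le w b]|]|.
Proof.
move=> Bt.
rewrite -[LHS]sum1_card big_mkcond big_sumType /= addnC; congr (_ + _); last first.
  by rewrite -sum1_card [RHS]big_mkcond /=; apply: eq_bigr => w _; rewrite !inE.
rewrite -big_mkcond /= sum1_card.
rewrite -(card_imset (mem [pred x : {w | term w} | inr x \in apex_cycle B]) val_inj).
apply: eq_card => w; apply/imsetP/idP => [[x]|wB].
  by rewrite !inE => xB ->.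
by exists (exist _ w (Bt _ wB)); rewrite ?inE.
Qed.

Definition below w : {set vertex apex_graph} := [set Some u | u : W & le w u].

Lemma in_below w (o : option W) : (o \in below w) = oapp (le w) false o.
Proof.
apply/imsetP/idP => [[u]|]; first by rewrite inE => wu ->.
by case: o => // u wu; exists u; rewrite ?inE.
Qed.

(** The only stem edge that leaves the subtree below [w] is the one above [w]. *)
Lemma odd_cut_stem w u : odd #|apex_ends (inl u) :&: below w| = (u == w).
Proof.
have [->|uw] := eqVneq u w.
  suff -> : apex_ends (inl w) :&: below w = [set Some w] by rewrite cards1.
  apply/setP=> o; rewrite inE in_below !inE.
  case: eqVneq => [-> /=|_ /=]; first by rewrite lexx.
  by case: eqVneq => // ->; case Dw: (par w) => //=; apply/negbTE/par_nle.
have leE : le w u = oapp (le w) false (par u) by rewrite le_par (negPf uw).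
have [wu|wNu] := boolP (le w u).
  rewrite (setIidPl _) ?apex_ends2 //; apply/subsetP => o; rewrite in_below !inE.
  by case/orP=> /eqP-> //=; rewrite -leE.
suff -> : apex_ends (inl u) :&: below w = set0 by rewrite cards0.
apply/setP=> o; rewrite inE in_below !inE; apply/negbTE.
by apply/negP => /andP[/orP[]/eqP->] /=; rewrite -?leE (negPf wNu).
Qed.

Lemma card_cut_back w (x : {w | term w}) :
  #|apex_ends (inr x) :&: below w| = le w (val x).
Proof.
case: (boolP (le w (val x))) => wx.
  suff -> : apex_ends (inr x) :&: below w = [set Some (val x)] by rewrite cards1.
  apply/setP=> o; rewrite inE in_below !inE.
  by case: eqVneq => [-> /=|_ /=]; [rewrite wx|case: eqVneq => // ->].
suff -> : apex_ends (inr x) :&: below w = set0 by rewrite cards0.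
apply/setP=> o; rewrite inE in_below !inE.
by case: eqVneq => [-> /=|_ /=]; [rewrite (negPf wx)|case: eqVneq => // ->].
Qed.

Section Cycle.
Variable C : {set edge apex_graph}.
Hypothesis Cc : is_cycle C.

Definition back_tips : {set W} :=
  [set val x | x : {w | term w} & (inr x : edge apex_graph) \in C].

Lemma in_back_tips x : (val x \in back_tips) = ((inr x : edge apex_graph) \in C).
Proof.
apply/imsetP/idP => [[y]|xC]; first by rewrite inE => yC /val_inj ->.
by exists x; rewrite ?inE.
Qed.

(** Parity of the cut between the subtree below [w] and the rest. *)
Lemma stem_in_cycle w :
  ((inl w : edge apex_graph) \in C) = odd #|[set b in back_tips | le w b]|.
Proof.
have := @cycle_cut_even apex_graph C (below w) apex_ends2 Cc.
rewrite big_mkcond big_sumType /= oddD.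
rewrite [X in X (+) _](_ : _ = ((inl w : edge apex_graph) \in C)); last first.
  rewrite (big_morph odd oddD (erefl : odd 0 = false)) (bigD1 w) //= big1 ?addbF.
    by case: ifP => //= _; rewrite (odd_cut_stem w w) eqxx.
  move=> u uw; case: ifP => //= _.
  by have := odd_cut_stem w u; rewrite (negPf uw).
rewrite [X in _ (+) odd X](_ : _ = #|[set b in back_tips | le w b]|).
  by case: (_ \in C) => /=; case: odd.
have -> : [set b in back_tips | le w b] =
    val @: [set x : {w | term w} | ((inr x : edge apex_graph) \in C) && le w (val x)].
  apply/setP=> b; rewrite !inE; apply/andP/imsetP => [[/imsetP[x]]|[x]].
    by rewrite inE => xC -> wx; exists x; rewrite ?inE ?xC.
  by rewrite inE => /andP[xC wx] ->; rewrite in_back_tips.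
rewrite (card_imset _ val_inj) -sum1_card [RHS]big_mkcond /=.
apply: eq_bigr => x _; rewrite inE; case: ifP => //= _.
by rewrite (card_cut_back w x); case: (le w _).
Qed.

Lemma cycleE : C = apex_cycle back_tips.
Proof. by apply/setP=> -[w|x]; rewrite inE ?stem_in_cycle ?in_back_tips. Qed.

Lemma hub_degree :
  #|back_tips| + #|[set r | (par r == None) && ((inl r : edge apex_graph) \in C)]| <= 2.
Proof.
suff -> : #|back_tips| + #|[set r | (par r == None) && ((inl r : edge apex_graph) \in C)]| =
    #|[set e in C | (None : vertex apex_graph) \in ends e]|.
  by case: (@cycle_degree apex_graph C None apex_ends2 Cc) => ->.
rewrite -[RHS]sum1_card big_mkcond big_sumType /= addnC; congr (_ + _); last first.
  rewrite -big_mkcond /= sum1_card (card_imset _ val_inj); apply: eq_card => x.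
  by rewrite [RHS](_ : _ = ((inr x : edge apex_graph) \in
    [set e in C | (None : vertex apex_graph) \in ends e])) // !inE /= ?inE /= ?orbT ?andbT.
rewrite -sum1_card [LHS]big_mkcond /=; apply: eq_bigr => w _; rewrite !inE /= ?inE /= andbC.
by rewrite [None == _]eq_sym.
Qed.

Lemma back_tips_gt0 : 0 < #|back_tips|.
Proof.
rewrite card_gt0; apply/eqP => B0.
case: Cc => k [v [e [k0 _ _ _ CE]]].
have : e (Ordinal k0) \in C by rewrite CE; apply: imset_f.
rewrite cycleE B0 inE; case: (e _) => [w|x]; last by rewrite inE.
suff -> : [set b in set0 | le w b] = set0 by rewrite cards0.
by apply/setP=> b; rewrite !inE.
Qed.

End Cycle.

(** If the two back edges of a cycle were at tips of different trees, the stem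
    edges above the two roots would also be in the cycle, and the hub would have
    degree 4. *)
Lemma cycle_apex (C : {set edge apex_graph}) : is_cycle C ->
  exists2 B, admissible B & C = apex_cycle B.
Proof.
move=> Cc; exists (back_tips C); last exact: cycleE.
have := hub_degree Cc; have := back_tips_gt0 Cc; have := stem_in_cycle Cc.
have Bt w : w \in back_tips C -> term w by case/imsetP=> x _ ->; exact: (valP x).
move: (back_tips C) Bt => B Bt stemE B0 hub.
have [/cards1P[b BE]|B1] := boolP (#|B| == 1).
  by left; exists b => //; apply: Bt; rewrite BE inE.
have B2 : #|B| == 2 by lia.
right; case/cards2P: B2 => b1 [b2 [b12 BE]].
exists b1, b2; split=> //; try by apply: Bt; rewrite BE !inE eqxx ?orbT.
move=> r rroot; apply/eqP; apply: contraT => neq.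
have rC : (inl r : edge apex_graph) \in C.
  rewrite stemE BE.
  have -> : [set b in [set b1; b2] | le r b] = [set (if le r b1 then b1 else b2)].
    apply/setP=> b; rewrite !inE; move: neq.
    have [->|bb1] := eqVneq b b1.
      by case: (le r b1) (le r b2) => -[] //= _; rewrite ?eqxx ?(negPf b12).
    have [->|bb2] := eqVneq b b2.
      by case: (le r b1) (le r b2) => -[] //= _; rewrite ?eqxx 1?eq_sym ?(negPf b12).
    by case: (le r b1); rewrite ?(negPf bb1) ?(negPf bb2).
  by rewrite cards1.
by move: hub; rewrite BE cards2 b12 (cardsD1 r) inE rroot eqxx rC; lia.
Qed.

End ApexGraph.

(** * Rooted forests and their cycle lengths *)

(** [Tip] is a single marked vertex, [Up f] adds a vertex that becomes the
    parent of all roots of [f], and [Join] is the disjoint union. *)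
Inductive forest := Empty | Tip | Up of forest | Join of forest & forest.

Fixpoint node (f : forest) : finType :=
  match f with
  | Empty => void
  | Tip => unit
  | Up g => (unit + node g)%type
  | Join g h => (node g + node h)%type
  end.

Fixpoint above (f : forest) : rel (node f) :=
  match f return rel (node f) with
  | Empty => fun _ _ => false
  | Tip => fun _ _ => true
  | Up g => fun u v => match u, v with
      | inl _, _ => true
      | inr _, inl _ => false
      | inr u, inr v => above u v
      end
  | Join g h => fun u v => match u, v with
      | inl u, inl v => above u v
      | inr u, inr v => above u v
      | _, _ => false
      end
  end.

Fixpoint parent (f : forest) : node f -> option (node f) :=
  match f return node f -> option (node f) with
  | Empty => fun _ => None
  | Tip => fun _ => None
  | Up g => fun v => match v with
      | inl _ => None
      | inr v => if parent v is Some u then Some (inr u) else Some (inl tt)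
      end
  | Join g h => fun v => match v with
      | inl v => omap inl (parent v)
      | inr v => omap inr (parent v)
      end
  end.

Fixpoint tips (f : forest) : seq (node f) :=
  match f return seq (node f) with
  | Empty => [::]
  | Tip => [:: tt]
  | Up g => map inr (tips g)
  | Join g h => map inl (tips g) ++ map inr (tips h)
  end.

(** Each pair of distinct tips is listed once, in one of its two orders. *)
Fixpoint tip_pairs (f : forest) : seq (node f * node f) :=
  match f return seq (node f * node f) with
  | Empty => [::]
  | Tip => [::]
  | Up g => [seq (inr p.1, inr p.2) | p <- tip_pairs g]
  | Join g h => [seq (inl p.1, inl p.2) | p <- tip_pairs g] ++
                [seq (inr p.1, inr p.2) | p <- tip_pairs h] ++
                [seq (inl u, inr v) | u <- tips g, v <- tips h]
  end.

(** The same restricted to pairs in a common tree: below an [Up] all tips are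
    in one tree, across a [Join] none are. *)
Fixpoint tree_pairs (f : forest) : seq (node f * node f) :=
  match f return seq (node f * node f) with
  | Empty => [::]
  | Tip => [::]
  | Up g => [seq (inr p.1, inr p.2) | p <- tip_pairs g]
  | Join g h => [seq (inl p.1, inl p.2) | p <- tree_pairs g] ++
                [seq (inr p.1, inr p.2) | p <- tree_pairs h]
  end.

(** The depth counts the vertices from the root to the tip, both included. *)
Fixpoint depths (f : forest) : seq nat :=
  match f with
  | Empty => [::]
  | Tip => [:: 1]
  | Up g => map S (depths g)
  | Join g h => depths g ++ depths h
  end.

(** Distances between tips, where all roots are taken to have a common parent. *)
Fixpoint dists (f : forest) : seq nat :=
  match f with
  | Empty => [::]
  | Tip => [::]
  | Up g => dists g
  | Join g h => dists g ++ dists h ++ [seq x + y | x <- depths g, y <- depths h]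
  end.

Fixpoint tree_dists (f : forest) : seq nat :=
  match f with
  | Empty => [::]
  | Tip => [::]
  | Up g => dists g
  | Join g h => tree_dists g ++ tree_dists h
  end.

Fixpoint size_forest (f : forest) : nat :=
  match f with
  | Empty => 0
  | Tip => 1
  | Up g => (size_forest g).+1
  | Join g h => size_forest g + size_forest h
  end.

Lemma card_node f : #|node f| = size_forest f.
Proof.
elim: f => [||g IH|g IHg h IHh] /=; rewrite ?card_void ?card_unit //.
  by rewrite card_sum card_unit IH.
by rewrite card_sum IHg IHh.
Qed.

Lemma above_parent f (u v : node f) :
  above u v = (v == u) || oapp (above u) false (parent v).
Proof.
elim: f u v => [||g IH|g IHg h IHh] /=.
- by case.
- by case=> -[].
- move=> [[]|u] [[]|v] //=.
  + by case: (parent v) => //= w; rewrite orbT.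
  + by rewrite IH; congr orb; case: (parent v).
- move=> [u|u] [v|v] //=; rewrite ?IHg ?IHh; try (congr orb); by case: (parent v).
Qed.

Lemma parent_nabove f (v u : node f) : parent v = Some u -> ~~ above v u.
Proof.
elim: f u v => [||g IH|g IHg h IHh] /=; try by [case|case=> -[]].
  move=> [[]|u] [[]|v] //=; case Dv: (parent v) => [w|] //= [<-]; exact: IH.
move=> [u|u] [v|v] //=; case Dv: (parent v) => [w|] //= [<-]; [exact: IHg|exact: IHh].
Qed.

Lemma root_above f (w : node f) : exists2 r : node f, parent r = None & above r w.
Proof.
elim: f w => [||f IH|f IHf g IHg] //=.
- by move=> w; exists (inl tt).
- case=> [w|w]; [have [r r0 rw] := IHf w | have [r r0 rw] := IHg w].
    by exists (inl r); rewrite //= r0.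
  by exists (inr r); rewrite //= r0.
Qed.

Lemma tips_uniq f : uniq (tips f).
Proof.
elim: f => [||g IH|g IHg h IHh] //=; first by rewrite map_inj_uniq // => x y [].
rewrite cat_uniq !map_inj_uniq ?IHg ?IHh /= ?andbT; try by move=> x y [].
by apply/hasPn => _ /mapP[x _ ->]; apply/mapP => -[].
Qed.

Lemma size_tips f : size (tips f) = size (depths f).
Proof.
by elim: f => [||g IH|g IHg h IHh] //=; rewrite ?size_cat !size_map ?IH ?IHg ?IHh.
Qed.

Definition depth f (v : node f) := \sum_u above u v.

(** The path between [v] and [w] consists of the stem edges above exactly one
    of them. *)
Definition dist f (v w : node f) := \sum_u (above u v (+) above u w).

Lemma depthsE f : map (@depth f) (tips f) = depths f.
Proof.
elim: f => [||g IH|g IHg h IHh] //=.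
- by rewrite /depth big_const card_unit /=.
- rewrite -IH -!map_comp; apply: eq_map => v /=.
  by rewrite /depth big_sumType /= big_const card_unit /= add1n.
rewrite map_cat -IHg -IHh -!map_comp; congr (_ ++ _); apply: eq_map => v /=;
  rewrite /depth big_sumType /= big1_eq ?addn0 //.
Qed.

Lemma distsE f : [seq dist p.1 p.2 | p <- tip_pairs f] = dists f.
Proof.
elim: f => [||g IH|g IHg h IHh] //=.
- rewrite -IH -!map_comp; apply: eq_map => v /=.
  by rewrite /dist big_sumType /= big_const card_unit /= add0n.
rewrite !map_cat -!map_comp -IHg -IHh -!depthsE; congr (_ ++ _ ++ _).
- by apply: eq_map => v /=; rewrite /dist big_sumType /= addnC big1_eq.
- by apply: eq_map => v /=; rewrite /dist big_sumType /= big1_eq.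
rewrite map_allpairs allpairs_mapl allpairs_mapr.
apply: eq_allpairs => u v /=; rewrite /dist big_sumType /=; congr (_ + _).
by apply: eq_bigr => w _; rewrite addbF.
Qed.

Lemma tree_distsE f : [seq dist p.1 p.2 | p <- tree_pairs f] = tree_dists f.
Proof.
elim: f => [||g IH|g IHg h IHh] //=.
- rewrite -distsE -!map_comp; apply: eq_map => v /=.
  by rewrite /dist big_sumType /= big_const card_unit /= add0n.
rewrite !map_cat -!map_comp -IHg -IHh; congr (_ ++ _).
- by apply: eq_map => v /=; rewrite /dist big_sumType /= addnC big1_eq.
- by apply: eq_map => v /=; rewrite /dist big_sumType /= big1_eq.
Qed.

Lemma tip_pairs_complete f (u v : node f) :
  u \in tips f -> v \in tips f -> u != v ->
  ((u, v) \in tip_pairs f) || ((v, u) \in tip_pairs f).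
Proof.
elim: f u v => [||g IH|g IHg h IHh] //=.
- move=> u v /mapP[u' uT ->] /mapP[v' vT ->] uv.
  have /orP[] := IH _ _ uT vT uv => p; apply/orP; [left|right];
  exact: (map_f (fun p => (inr p.1, inr p.2)) p).
move=> u v; rewrite !mem_cat.
move=> /orP[] /mapP[u' uT ->] /orP[] /mapP[v' vT ->] uv.
- have /orP[] := IHg _ _ uT vT uv => p; apply/orP; [left|right];
  by rewrite (map_f (fun p => (inl p.1, inl p.2)) p).
- by rewrite (allpairs_f (fun u v => (inl u, inr v)) uT vT) !orbT.
- by rewrite (allpairs_f (fun u v => (inl u, inr v)) vT uT) !orbT.
- have /orP[] := IHh _ _ uT vT uv => p; apply/orP; [left|right];
  by rewrite (map_f (fun p => (inr p.1, inr p.2)) p) !orbT.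
Qed.

Lemma tree_pairs_complete f (u v : node f) :
  u \in tips f -> v \in tips f -> u != v ->
  (forall r, parent r = None -> above r u = above r v) ->
  ((u, v) \in tree_pairs f) || ((v, u) \in tree_pairs f).
Proof.
elim: f u v => [||g IH|g IHg h IHh] //=.
- move=> u v uT vT uv _; exact: (@tip_pairs_complete (Up g)).
move=> u v; rewrite !mem_cat.
move=> /orP[] /mapP[u' uT ->] /orP[] /mapP[v' vT ->] uv roots.
- have roots' r : parent r = None -> above r u' = above r v'.
    by move=> r0; have := roots (inl r); rewrite /= r0; apply.
  have /orP[p|p] := IHg _ _ uT vT uv roots'.
  + by rewrite (map_f (fun p => (inl p.1, inl p.2)) p).
  + by rewrite (map_f (fun p => (inl p.1, inl p.2)) p) !orbT.
- by have [r r0 ru] := root_above u'; have := roots (inl r); rewrite /= r0 ru => /(_ erefl).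
- by have [r r0 ru] := root_above u'; have := roots (inr r); rewrite /= r0 ru => /(_ erefl).
- have roots' r : parent r = None -> above r u' = above r v'.
    by move=> r0; have := roots (inr r); rewrite /= r0; apply.
  have /orP[p|p] := IHh _ _ uT vT uv roots'.
  + by rewrite (map_f (fun p => (inr p.1, inr p.2)) p) !orbT.
  + by rewrite (map_f (fun p => (inr p.1, inr p.2)) p) !orbT.
Qed.

Lemma tip_pairs_tips f (p : node f * node f) : p \in tip_pairs f ->
  [/\ p.1 \in tips f, p.2 \in tips f & p.1 != p.2].
Proof.
elim: f p => [||g IH|g IHg h IHh] //= p.
  by case/mapP=> x /IH[x1 x2 x12] -> /=; split=> //; apply: map_f.
rewrite !mem_cat => /or3P[] /=.
- by case/mapP=> x /IHg[x1 x2 x12] -> /=; split; rewrite ?mem_cat ?map_f //.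
- by case/mapP=> x /IHh[x1 x2 x12] -> /=; split; rewrite ?mem_cat ?map_f ?orbT //.
- by case/allpairsP=> x [x1 x2 ->] /=; split; rewrite ?mem_cat ?map_f ?orbT //.
Qed.

Lemma tree_pairs_tips f (p : node f * node f) : p \in tree_pairs f ->
  [/\ p.1 \in tips f, p.2 \in tips f & p.1 != p.2].
Proof.
elim: f p => [||g IH|g IHg h IHh] //= p; first exact: (@tip_pairs_tips (Up g)).
rewrite mem_cat => /orP[] /=.
- by case/mapP=> x /IHg[x1 x2 x12] -> /=; split; rewrite ?mem_cat ?map_f //.
- by case/mapP=> x /IHh[x1 x2 x12] -> /=; split; rewrite ?mem_cat ?map_f ?orbT //.
Qed.

(** The lengths of all cycles of the graph of [f]: one back edge and the stem
    edges down to a tip, or two back edges and the path between their tips. *)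
Definition spectrum f := map S (depths f) ++ [seq x.+2 | x <- tree_dists f].

Definition term f : pred (node f) := [in tips f].

Definition forest_graph f := apex_graph (@term f) (@above_parent f) (@parent_nabove f).

Lemma forest_graph_distinct f : uniq (spectrum f) ->
  distinct_cycle_lengths (forest_graph f).
Proof.
move=> uf.
pose cyc (B : {set node f}) := apex_cycle (@term f) (@above_parent f) (@parent_nabove f) B.
(* the admissible sets of tips, in the order of the spectrum *)
pose L := [seq [set v] | v <- tips f] ++ [seq [set p.1; p.2] | p <- tree_pairs f].
have LE : [seq #|cyc B| | B <- L] = spectrum f.
  rewrite /spectrum /L map_cat -depthsE -tree_distsE -!map_comp; congr (_ ++ _).
    apply/eq_in_map => v vT /=; rewrite card_apex_cycle; last by move=> x; rewrite inE => /eqP->.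
    rewrite cards1 add1n; congr _.+1; rewrite -sum1_card big_mkcond /=.
    apply: eq_bigr => u _; rewrite inE.
    have -> : [set b in [set v] | above u b] = if above u v then [set v] else set0.
      apply/setP=> b; rewrite !inE; case: eqVneq => [->|bv] /=; case: ifP; rewrite ?inE ?eqxx //.
      by rewrite (negPf bv).
    by case: (above u v); rewrite ?cards1 ?cards0.
  apply/eq_in_map => p /tree_pairs_tips[p1 p2 p12] /=.
  rewrite card_apex_cycle; last by move=> x; rewrite !inE => /orP[] /eqP->.
  rewrite cards2 p12 add2n; congr _.+2; rewrite -sum1_card big_mkcond /=.
  apply: eq_bigr => u _; rewrite inE -sum1_card.
  rewrite (eq_bigl (fun b => (b \in [set p.1; p.2]) && above u b)); last by move=> b; rewrite inE.
  rewrite big_mkcondr big_setU1 ?inE //= big_set1.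
  by case: above; case: above.
have inL B : admissible (@parent f) (@above f) (@term f) B -> B \in L.
  case=> [[b bT ->]|[b1 [b2 [b1T b2T b12 -> roots]]]]; rewrite mem_cat.
    by rewrite (map_f (fun v => [set v]) bT).
  apply/orP; right.
  have /orP[p|p] := tree_pairs_complete b1T b2T b12 roots.
    exact: (map_f (fun p : node f * node f => [set p.1; p.2]) p).
  by rewrite setUC; exact: (map_f (fun p : node f * node f => [set p.1; p.2]) p).
have cyc_inj : {in L &, injective (fun B => #|cyc B|)}.
  move=> B B' BL B'L eqB.
  have sL : size L = size (spectrum f) by rewrite -LE size_map.
  rewrite -(nth_index set0 BL) -(nth_index set0 B'L); congr nth.
  apply/eqP; rewrite -(nth_uniq 0 _ _ uf) -?sL ?index_mem //.
  by rewrite -LE !(nth_map set0) ?index_mem // !nth_index //; apply/eqP.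
move=> C D /cycle_apex[B Bad ->] /cycle_apex[B' B'ad ->] neq eqc; apply: neq.
by congr apex_cycle; apply: cyc_inj eqc; apply: inL.
Qed.

Lemma forest_attainable f : uniq (spectrum f) ->
  attainable (size_forest f).+1 (size_forest f + size (depths f)).
Proof.
move=> /forest_graph_distinct dG; apply/asboolP; exists (forest_graph f); split=> //=.
  by rewrite card_option card_node.
rewrite card_sum card_node card_sig -size_tips; congr (_ + _).
by rewrite -(card_uniqP (tips_uniq f)); apply: eq_card => v; rewrite !inE.
Qed.

Definition ups n f := iter n Up f.

Lemma depths_ups n f : depths (ups n f) = [seq n + x | x <- depths f].
Proof.
elim: n => [|n IH] /=; first by rewrite map_id.
by rewrite IH -map_comp; apply: eq_map => x /=; rewrite addSn.
Qed.

Lemma dists_ups n f : dists (ups n f) = dists f.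
Proof. by elim: n. Qed.

Lemma size_ups n f : size_forest (ups n f) = n + size_forest f.
Proof. by elim: n => //= n ->. Qed.

Definition joins := foldr Join Empty.

Lemma spectrum_join f g : perm_eq (spectrum (Join f g)) (spectrum f ++ spectrum g).
Proof.
rewrite /spectrum /= !map_cat -!catA perm_cat2l.
by rewrite catA [X in perm_eq _ X]catA perm_cat2r perm_catC.
Qed.

Lemma spectrum_joins fs : perm_eq (spectrum (joins fs)) (flatten (map spectrum fs)).
Proof.
elim: fs => //= f fs IH; apply: perm_trans (spectrum_join _ _) _.
by rewrite perm_cat2l.
Qed.

Lemma size_joins fs : size_forest (joins fs) = sumn (map size_forest fs).
Proof. by elim: fs => //= f fs ->. Qed.

Lemma size_depths_joins fs :
  size (depths (joins fs)) = sumn [seq size (depths f) | f <- fs].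
Proof. by elim: fs => //= f fs <-; rewrite size_cat. Qed.

(** * Scaled copies of tree templates *)

(** The two numbers on a segment are its coarse length y and its residue r. *)
Inductive template := Leaf of nat & nat | Fork of nat & nat & template & template.

Fixpoint leaves t := if t is Fork _ _ a b then leaves a + leaves b else 1.

Fixpoint cell_sum t :=
  match t with Leaf y _ => y | Fork y _ a b => y + cell_sum a + cell_sum b end.

Fixpoint residue_sum t :=
  match t with Leaf _ r => r | Fork _ r a b => r + residue_sum a + residue_sum b end.

Definition shift (p z : nat * nat) := (p.1 + z.1, p.2 + z.2).

Fixpoint leaf_depths t : seq (nat * nat) :=
  match t with
  | Leaf y r => [:: (y, r)]
  | Fork y r a b => [seq shift (y, r) z | z <- leaf_depths a ++ leaf_depths b]
  end.

Fixpoint leaf_dists t : seq (nat * nat) :=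
  match t with
  | Leaf _ _ => [::]
  | Fork _ _ a b => leaf_dists a ++ leaf_dists b ++
                    [seq shift x z | x <- leaf_depths a, z <- leaf_depths b]
  end.

Definition cycles t := leaf_depths t ++ leaf_dists t.

Lemma perm_allpairs_swap (A B : Type) (C : eqType) (g : A -> B -> C) s t :
  perm_eq [seq g x y | x <- s, y <- t] [seq g x y | y <- t, x <- s].
Proof.
elim: s => [|x s IH] /=; first by elim: t.
apply: perm_trans (_ : perm_eq _ ([seq g x y | y <- t] ++ [seq g x y | y <- t, x <- s])) _.
  by rewrite perm_cat2l.
elim: t {IH} => //= y t IH; rewrite perm_cons.
by rewrite perm_catCA perm_cat2l.
Qed.

Section Copies.
Variable h : nat.
Hypothesis h_gt0 : 0 < h.

(** The last edge on the way to a tip is the back edge of that tip, which is not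
    part of the forest: a leaf segment of length l has l - 1 edges here.  As
    [Tip] itself accounts for one of them, it stands below l - 2 vertices. *)
Fixpoint grow (M i : nat) t : forest :=
  match t with
  | Leaf y r => ups (h * (M * y + i) + r).-2 Tip
  | Fork y r a b => ups (h * (M * y) + r) (Join (grow M i a) (grow M i b))
  end.

(** The topmost segment ends at the hub, hence it also gets the extra h * i. *)
Definition tree M i t := ups (h * i) (grow M i t).

Definition cycle_length M i (p : nat * nat) := h * (M * p.1 + 2 * i) + p.2.

Lemma depths_grow M i t : 1 < i ->
  depths (grow M i t) = [seq (h * (M * p.1 + i) + p.2).-1 | p <- leaf_depths t].
Proof.
move=> i1; elim: t => [y r|y r a IHa b IHb] /=.
  by rewrite depths_ups /=; congr [:: _]; nia.
rewrite depths_ups /= IHa IHb -map_cat -!map_comp; apply: eq_map => p /=.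
nia.
Qed.

Lemma dists_grow M i t : 1 < i ->
  dists (grow M i t) = [seq (cycle_length M i p).-2 | p <- leaf_dists t].
Proof.
move=> i1; elim: t => [y r|y r a IHa b IHb] /=; rewrite dists_ups //=.
rewrite IHa IHb !map_cat !depths_grow //; congr (_ ++ (_ ++ _)).
rewrite map_allpairs allpairs_mapl allpairs_mapr; apply: eq_allpairs => x z /=.
by rewrite /cycle_length /=; nia.
Qed.

Lemma spectrum_tree M i t : 1 < i ->
  spectrum (tree M i t) = [seq cycle_length M i p | p <- cycles t].
Proof.
move=> i1; rewrite /spectrum /tree.
have -> : tree_dists (ups (h * i) (grow M i t)) = dists (grow M i t).
  have : 0 < h * i by nia.
  by case: (h * i) => // n _; rewrite -[RHS](dists_ups n).
rewrite depths_ups depths_grow // dists_grow // map_cat -!map_comp; congr (_ ++ _);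
  apply: eq_map => p; rewrite /= /cycle_length; nia.
Qed.

Lemma size_depths_tree M i t : size (depths (tree M i t)) = leaves t.
Proof.
rewrite depths_ups size_map; elim: t => [y r|y r a IHa b IHb] /=.
  by rewrite depths_ups.
by rewrite depths_ups size_map size_cat IHa IHb.
Qed.

Lemma size_tree M i t : 1 < i ->
  size_forest (tree M i t) <= h * (M * cell_sum t + (leaves t).+1 * i) + residue_sum t.
Proof.
move=> i1; rewrite size_ups.
suff : size_forest (grow M i t) <= h * (M * cell_sum t + leaves t * i) + residue_sum t by nia.
elim: t => [y r|y r a IHa b IHb] /=; rewrite size_ups /=; nia.
Qed.

Variable ts : seq template.
Let all_cycles := flatten (map cycles ts).

Definition copies M (I : seq nat) := joins [seq tree M i t | t <- ts, i <- I].

Lemma spectrum_copies M I : all (leq 2) I ->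
  perm_eq (spectrum (copies M I)) [seq cycle_length M i p | p <- all_cycles, i <- I].
Proof.
move=> I1; apply: perm_trans (spectrum_joins _) _; rewrite /all_cycles.
elim: ts => //= t s IH; rewrite map_cat flatten_cat allpairs_cat.
apply: perm_cat IH; rewrite -map_comp.
have -> : flatten (map (spectrum \o tree M^~ t) I) = [seq cycle_length M i p | i <- I, p <- cycles t].
  congr flatten; apply/eq_in_map => i /(allP I1) i1; exact: spectrum_tree.
exact: perm_allpairs_swap.
Qed.

(** [K] bounds how far the residues can push a length past the next multiples
    of 2 * h. *)
Definition admissible_templates K :=
  all (fun p : nat * nat => ~~ odd p.1 && (p.2 < 2 * h * K.-1)) all_cycles &&
  uniq [seq (p.1, p.2 %% (2 * h)) | p <- all_cycles].

(** Writing Y = 2 * X and R = 2 * h * c + r, the length is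
    2 * h * (M * X + (i + c)) + r with i + c < M, so it determines r, X and
    i + c; the first two determine the cycle of the template, hence c and i. *)
Lemma copies_uniq K M : 1 < K -> admissible_templates K ->
  uniq (spectrum (copies M (iota 2 (M - K)))).
Proof.
move=> K1 /andP[/allP ok uniq_slots].
rewrite (perm_uniq (spectrum_copies _ _)); last by apply/allP => i; rewrite mem_iota; lia.
have slot_inj : {in all_cycles &, injective (fun p : nat * nat => (p.1, p.2 %% (2 * h)))}.
  move=> p p' pc p'c eqp.
  rewrite -(nth_index (0, 0) pc) -(nth_index (0, 0) p'c); congr nth.
  apply/eqP; rewrite -(nth_uniq (0, 0) _ _ uniq_slots) ?size_map ?index_mem //.
  by rewrite !(nth_map (0, 0)) ?index_mem // !nth_index //; apply/eqP.
apply: allpairs_uniq; [exact: map_uniq uniq_slots|exact: iota_uniq|].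
move=> _ _ /allpairsP[[p i] /= [pc iI ->]] /allpairsP[[p' i'] /= [p'c i'I ->]] /=.
rewrite /cycle_length !mem_iota in iI i'I *.
have /andP[ev lt] := ok _ pc; have /andP[ev' lt'] := ok _ p'c.
have d0 : 0 < 2 * h by lia.
have dE (z : nat * nat) j : ~~ odd z.1 ->
    h * (M * z.1 + 2 * j) + z.2 = (M * z.1./2 + (j + z.2 %/ (2 * h))) * (2 * h) + z.2 %% (2 * h).
  move=> evz; rewrite -{1}(odd_double_half z.1) (negPf evz) {1}(divn_eq z.2 (2 * h)); nia.
rewrite !dE // => eqz.
have c_lt z : z < 2 * h * K.-1 -> z %/ (2 * h) < K.-1.
  by move=> zl; rewrite ltn_divLR // mulnC.
have cl := c_lt _ lt; have cl' := c_lt _ lt'.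
have req : p.2 %% (2 * h) = p'.2 %% (2 * h).
  by have := congr1 (modn^~ (2 * h)) eqz; rewrite /= !modnMDl !modn_mod.
have qeq : M * p.1./2 + (i + p.2 %/ (2 * h)) = M * p'.1./2 + (i' + p'.2 %/ (2 * h)).
  have := congr1 (divn^~ (2 * h)) eqz.
  by rewrite /= !divnMDl // !(divn_small (ltn_pmod _ d0)) !addn0.
have M0 : 0 < M by lia.
have sl : i + p.2 %/ (2 * h) < M by lia.
have sl' : i' + p'.2 %/ (2 * h) < M by lia.
have Xeq : p.1./2 = p'.1./2.
  have := congr1 (divn^~ M) qeq.
  by rewrite /= ![M * _]mulnC !divnMDl // !(divn_small sl) !(divn_small sl') !addn0.
have pE : p = p'.
  apply: slot_inj => //; congr pair => //.
  by rewrite -(odd_double_half p.1) -(odd_double_half p'.1) (negPf ev) (negPf ev') Xeq.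
by congr pair => //; move: qeq; rewrite pE; lia.
Qed.

(** The i-th copy has about h * (M * cell_sum + (leaves + 1) * i) vertices, and
    twice the sum of the i below M is at most M ^ 2. *)
Lemma size_copies M K : 1 < K ->
  2 * size_forest (copies M (iota 2 (M - K))) <=
  h * M ^ 2 * (2 * sumn (map cell_sum ts) + sumn [seq (leaves t).+1 | t <- ts])
   + 2 * M * sumn (map residue_sum ts).
Proof.
move=> K1; rewrite size_joins; elim: ts => [|t s IH] /=; first by [].
rewrite map_cat sumn_cat.
suff : 2 * sumn (map size_forest (map (tree M ^~ t) (iota 2 (M - K)))) <=
   h * M ^ 2 * (2 * cell_sum t + (leaves t).+1) + 2 * M * residue_sum t by move: IH; nia.
have H n : 2 * sumn (map size_forest (map (tree M ^~ t) (iota 2 n))) <=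
   2 * n * (h * M * cell_sum t + residue_sum t) + h * (leaves t).+1 * (n * (n + 3)).
  elim: n => [|n IHn] //.
  have -> : iota 2 n.+1 = iota 2 n ++ [:: 2 + n] by rewrite -(addn1 n) iotaD.
  rewrite !map_cat sumn_cat /= addn0.
  have := @size_tree M (2 + n) t isT. nia.
apply: leq_trans (H _) _.
have [MK|MK] := leqP M K; first by have -> : M - K = 0; [lia|rewrite !(muln0, mul0n)].
have : (M - K) * (M - K + 3) <= M ^ 2 by nia.
have : M - K <= M by lia.
nia.
Qed.

Lemma leaves_copies M I :
  size (depths (copies M I)) = size I * sumn (map leaves ts).
Proof.
rewrite size_depths_joins; elim: ts => [|t s IH] /=; first by rewrite muln0.
rewrite map_cat sumn_cat IH mulnDr; congr (_ + _).
by elim: I {IH} => //= i I' ->; rewrite size_depths_tree mulSn.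
Qed.

End Copies.

(** * Edge counts for every number of vertices *)

Lemma leq_max_edges n m : attainable n m -> m <= max_edges n.
Proof. by rewrite /max_edges; case: ex_maxnP => e _ max_e; exact: max_e. Qed.

(** A path without tips, attached to the hub, brings the number of vertices up
    to [n] without creating cycles. *)
Lemma max_edges_copies h ts K M n : 0 < h -> 1 < K -> admissible_templates h ts K ->
  size_forest (copies h ts M (iota 2 (M - K))) < n ->
  n.-1 + (M - K) * sumn (map leaves ts) <= max_edges n.
Proof.
move=> h0 K1 ok lt_n; apply: leq_max_edges.
set F := copies _ _ _ _ in lt_n.
pose G := Join F (ups (n.-1 - size_forest F) Empty).
have -> : n.-1 + (M - K) * sumn (map leaves ts) = size_forest G + size (depths G).
  rewrite /= size_ups size_cat depths_ups /= leaves_copies size_iota.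
  lia.
have sG : (size_forest G).+1 = n by rewrite /= size_ups /=; lia.
rewrite -[X in attainable X _]sG; apply: forest_attainable.
rewrite (perm_uniq (spectrum_join _ _)) /=.
rewrite {2}/spectrum depths_ups /=.
have -> : tree_dists (ups (n.-1 - size_forest F) Empty) = [::].
  by case: (_ - _) => //= m; rewrite dists_ups.
by rewrite cats0; exact: copies_uniq.
Qed.

(** The copies have asymptotically [weight] / 2 * M ^ 2 vertices. *)
Definition weight h ts :=
  h * (2 * sumn (map cell_sum ts) + sumn [seq (leaves t).+1 | t <- ts]).

Definition overhead ts K := (sumn (map residue_sum ts) + K).+1 * sumn (map leaves ts) + 1.

(** With R the sum of all residues, C * M ^ 2 + 2 * M * R <= C * (M + R) ^ 2;
    the largest N with C * N ^ 2 < 2 * n therefore allows M = N - R.  The lemma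
    gives N + 1, for which the first inequality holds. *)
Lemma max_edges_ge h ts K n : 0 < h -> 1 < K -> admissible_templates h ts K ->
  0 < weight h ts -> 0 < n ->
  exists N, 2 * n <= weight h ts * N ^ 2 /\
    n + N * sumn (map leaves ts) <= max_edges n + overhead ts K.
Proof.
set C := weight h ts; set R := sumn (map residue_sum ts) => h0 K1 ok C0 n0.
pose P N := C * N ^ 2 < 2 * n.
have exP : exists N, P N by exists 0; rewrite /P; lia.
have bndP N : P N -> N <= 2 * n by rewrite /P; nia.
case: (ex_maxnP exP bndP) => N PN maxN; exists N.+1; split.
  by rewrite leqNgt; apply/negP => /maxN; rewrite ltnn.
have small : size_forest (copies h ts (N - R) (iota 2 (N - R - K))) < n.
  have := size_copies h0 ts (N - R) K1.
  rewrite -/R [h * _ * _]mulnAC -/(weight h ts) -/C; move: PN; rewrite /P => PN le_size.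
  suff : C * (N - R) ^ 2 + 2 * (N - R) * R <= C * N ^ 2 by lia.
  have [NR|/ltnW NR] := leqP N R.
    by have -> : N - R = 0; [lia|rewrite muln0 mul0n exp0n // muln0].
  rewrite -{3}(subnK NR); have := leq_pmull ((N - R) * R) C0.
  by move: (N - R) => x; rewrite sqrnD !mulnDr; nia.
have := max_edges_copies h0 K1 ok small.
rewrite /overhead -/R; nia.
Qed.

(** * The lower limit *)

From mathcomp Require Import all_order all_algebra.
From mathcomp Require Import all_classical all_reals all_analysis.
From mathcomp Require Import lra.
Import Order.TTheory GRing.Theory Num.Theory.
Import numFieldNormedType.Exports.
Local Open Scope ring_scope.

Lemma limn_einf_ge (R : realType) (u v : nat -> R) (l : R) :
  (forall n, (0 < n)%N -> v n <= u n) -> (v @ \oo --> l)%classic ->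
  (l%:E <= limn_einf (fun n => (u n)%:E))%E.
Proof.
move=> vu vl.
have evl : ((fun n => (v n)%:E) @ \oo --> l%:E)%classic.
  by apply: cvg_EFin vl; exact: nearW.
have [<- _] := cvg_limn_einf_sup evl.
rewrite !limn_einf_lim; apply: lee_lim; [exact: is_cvg_einfs|exact: is_cvg_einfs|].
exists 1%N => // n /= n1; apply: le_ereal_inf_tmp => _ [m /= nm <-].
apply: le_trans (_ : (v m)%:E <= _)%E; last by rewrite lee_fin vu // (leq_trans n1).
by apply: ereal_inf_lbound; exists m.
Qed.

Lemma limn_einf_copies (R : realType) h ts K :
  (0 < h)%N -> (1 < K)%N -> admissible_templates h ts K -> (0 < weight h ts)%N ->
  ((Num.sqrt (2 * (sumn (map leaves ts))%:R ^+ 2 / (weight h ts)%:R : R))%:E <=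
   limn_einf (fun n : nat =>
     (((max_edges n)%:R - n%:R) / Num.sqrt n%:R : R)%:E))%E.
Proof.
set C := weight h ts; set G := sumn _; set D := overhead ts K => h0 K1 ok C0.
apply: (@limn_einf_ge _ _
  (fun n => Num.sqrt (2 * G%:R ^+ 2 / C%:R) - D%:R * Num.sqrt (n%:R^-1))).
  move=> n n0.
  have [N [CN maxN]] := max_edges_ge h0 K1 ok C0 n0.
  have n0R : 0 < n%:R :> R by rewrite ltr0n.
  have C0R : 0 < C%:R :> R by rewrite ltr0n.
  have sn0 : 0 < Num.sqrt n%:R :> R by rewrite sqrtr_gt0.
  rewrite ler_pdivlMr // mulrBl.
  have -> : D%:R * Num.sqrt (n%:R^-1) * Num.sqrt n%:R = D%:R :> R.
    by rewrite -mulrA sqrtrV ?ler0n // mulVf ?gt_eqF // mulr1.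
  have {}maxN : n%:R + N%:R * G%:R <= (max_edges n)%:R + D%:R :> R.
    by rewrite -natrM -!natrD ler_nat.
  suff : Num.sqrt (2 * G%:R ^+ 2 / C%:R) * Num.sqrt n%:R <= N%:R * G%:R :> R by lra.
  rewrite -sqrtrM ?divr_ge0 ?mulr_ge0 ?exprn_ge0 ?ler0n //.
  rewrite -[leRHS]ger0_norm ?mulr_ge0 ?ler0n // -sqrtr_sqr ler_sqrt ?exprn_ge0 ?mulr_ge0 ?ler0n //.
  rewrite mulrAC ler_pdivrMr //.
  have {}CN : 2 * n%:R <= C%:R * N%:R ^+ 2 :> R by rewrite -natrX -!natrM ler_nat.
  have := ler_wpM2l (exprn_ge0 2 (ler0n R G)) CN; lra.
have inv0 : ((fun n : nat => n%:R^-1 : R) @ \oo --> (0 : R))%classic.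
  apply/gtr0_cvgV0; last exact: cvgr_idn.
  by exists 1%N => // n /= n1; rewrite ltr0n.
rewrite -[X in (_ --> X)%classic]subr0 -[X in (_ --> _ - X)%classic](mulr0 D%:R).
apply: cvgB; first exact: cvg_cst.
apply: cvgMr; rewrite -[X in (_ --> X)%classic](sqrtr0 R).
apply: (cvg_comp _ _ inv0 (@sqrt_continuous R 0)).
Qed.

(** * A packing of templates *)

(** Found by a computer search that maximizes 2 * G ^ 2 / W.  Here h = 4, so
    lengths are sorted into slots (Y / 2, R mod 8), indexed by 8 * (Y / 2) + R.
    The larger trees cover every slot with 8 <= Y / 2 <= 21 and some later
    ones, and in addition the slot (7, 0) of index 56; single paths use all
    other slots with Y / 2 < 8. *)
Definition packing : seq template :=
  [seq Leaf (2 * (s %/ 8)) (s %% 8) | s <- iota 0 56 ++ iota 57 7] ++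
  [:: Fork 5 1 (Leaf 9 7) (Leaf 11 4);
     Fork 7 1 (Leaf 9 5) (Leaf 11 7);
     Fork 8 5 (Leaf 8 4) (Leaf 12 3);
     Fork 13 0 (Leaf 3 2) (Fork 14 2 (Leaf 9 0) (Leaf 9 4));
     Fork 9 2 (Leaf 9 1) (Fork 9 1 (Leaf 6 3) (Fork 9 3 (Leaf 7 2) (Leaf 13 0)));
     Fork 9 4 (Leaf 9 3) (Fork 9 1 (Leaf 6 5) (Fork 9 3 (Leaf 7 4) (Leaf 13 2)));
     Fork 11 2 (Leaf 9 3) (Fork 9 1 (Leaf 12 2) (Fork 10 0 (Leaf 8 3) (Leaf 8 1)));
     Fork 11 4 (Leaf 9 5) (Fork 9 1 (Leaf 12 4) (Fork 10 0 (Leaf 8 5) (Leaf 8 3)));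
     Fork 11 2 (Leaf 11 1) (Fork 5 2 (Leaf 8 0) (Fork 10 1 (Leaf 8 1)
       (Fork 12 2 (Leaf 10 1) (Fork 7 2 (Leaf 11 0) (Fork 6 1 (Leaf 9 0) (Leaf 9 2))))));
     Fork 11 4 (Leaf 11 3) (Fork 5 2 (Leaf 8 2) (Fork 10 1 (Leaf 8 3)
       (Fork 12 2 (Leaf 10 3) (Fork 7 2 (Leaf 11 2) (Fork 6 1 (Leaf 9 2) (Leaf 9 4))))));
     Fork 11 1 (Leaf 5 2) (Fork 9 0 (Leaf 8 3) (Fork 14 2 (Fork 10 0 (Leaf 12 3) (Leaf 6 2))
       (Fork 8 1 (Leaf 12 1) (Fork 7 0 (Leaf 13 2) (Leaf 9 0)))));
     Fork 11 3 (Leaf 5 4) (Fork 9 0 (Leaf 8 5) (Fork 14 2 (Fork 10 0 (Leaf 12 5) (Leaf 6 4))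
       (Fork 8 1 (Leaf 12 3) (Fork 7 0 (Leaf 13 4) (Leaf 9 2)))))].

Lemma packing_admissible : admissible_templates 4 packing 4.
Proof. by vm_compute. Qed.

Lemma packing_leaves : sumn (map leaves packing) = 116%N.
Proof. by vm_compute. Qed.

(* A product of small factors, to avoid a large unary numeral. *)
Lemma packing_weight : weight 4 packing = (4 * 43 * 65)%N.
Proof. by vm_compute. Qed.

Theorem mainTheorem3 (R : realType) :
  ((Num.sqrt (2 + 40 / 99 : R))%:E <=
   limn_einf (fun n : nat =>
     (((max_edges n)%:R - n%:R) / Num.sqrt n%:R : R)%:E))%E.
Proof.
have W0 : (0 < weight 4 packing)%N by rewrite packing_weight.
apply: le_trans (limn_einf_copies R _ _ packing_admissible W0) => //.
rewrite lee_fin packing_leaves packing_weight ler_sqrt; last first.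
  by rewrite divr_ge0 ?mulr_ge0 ?exprn_ge0 ?ler0n.
by rewrite !natrM; lra.
Qed.
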